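(* Let $\Delta$ be a hierarchical model, i.e. an abstract simplicial complex of subsets of $[m]$, with numbers of levels $I_1,\dots,I_m\ge 2$. Assume that the numbers $|\mathcal{I}_D|$, $D\in\mathrm{facet}(\Delta)$, are distinct and that $I_j>2$ except for at most one $j\in[m]$. Then the group of invariance $G_{\ker A_\Delta}$ is given, as a subgroup of $S_{\mathcal{I}}$, by $$G_{\ker A_\Delta}=\bigcap_{D\in\mathrm{facet}(\Delta)}\bigl(S_{\mathcal{I}_{D^C}}\ \mathrm{wr}\ S_{\mathcal{I}_D}\bigr).$$
   Context: Setting. Let $m\ge 1$, $[m]=\{1,\dots,m\}$, and let $I_1,\dots,I_m\ge 2$ be integers (numbers of levels). Put $\mathcal{I}_j=\{1,\dots,I_j\}$ and $\mathcal{I}=\mathcal{I}_1\times\cdots\times\mathcal{I}_m$ (the set of cells). For $D\subset[m]$ let $D^C=[m]\setminus D$, $\mathcal{I}_D=\prod_{j\in D}\mathcal{I}_j$ (a one-element set if $D=\emptyset$), and for $\mathbf{i}=(i_1,\dots,i_m)\in\mathcal{I}$ let $\mathbf{i}_D=(i_j)_{j\in D}\in\mathcal{I}_D$. Here $\subset$ allows equality. A hierarchical model is an abstract simplicial complex $\Delta$ of subsets of $[m]$ (not every $j\in[m]$ need be a vertex of $\Delta$); $\mathrm{facet}(\Delta)=\{D_1,\dots,D_K\}$ denotes its set of maximal simplices. $A_\Delta$ is the $0/1$ matrix with columns indexed by $\mathbf{i}\in\mathcal{I}$ and rows indexed by pairs $(k,\mathbf{j})$ with $1\le k\le K$, $\mathbf{j}\in\mathcal{I}_{D_k}$,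 whose entry in row $(k,\mathbf{j})$ and column $\mathbf{i}$ is $1$ if $\mathbf{i}_{D_k}=\mathbf{j}$ and $0$ otherwise. It is regarded as a linear map on $\mathbb{Q}^{\mathcal{I}}$, with kernel $\ker A_\Delta$. Thus $\ker A_\Delta$ consists of all $y\in\mathbb{Q}^{\mathcal{I}}$ such that $\sum_{\mathbf{j}\in\mathcal{I},\,\mathbf{j}_D=\mathbf{i}_D}y(\mathbf{j})=0$ for all $D\in\mathrm{facet}(\Delta)$ and all $\mathbf{i}_D\in\mathcal{I}_D$. The symmetric group $S_{\mathcal{I}}$ of all permutations of $\mathcal{I}$ acts on $\mathbb{Q}^{\mathcal{I}}$ by $(gy)(\mathbf{i})=y(g^{-1}(\mathbf{i}))$. For a subspace $L\subset\mathbb{Q}^{\mathcal{I}}$, $G_L=\{g\in S_{\mathcal{I}}\mid gL=L\}$ is its set-wise stabilizer. The group of invariance of the model $\Delta$ is $G_{\ker A_\Delta}$. For $D\subset[m]$, $S_{\mathcal{I}_D}$ and $S_{\mathcal{I}_{D^C}}$ are the symmetric groups on $\mathcal{I}_D$ and $\mathcal{I}_{D^C}$. The wreath product $S_{\mathcal{I}_{D^C}}\,\mathrm{wr}\,S_{\mathcal{I}_D}$ is the set $S_{\mathcal{I}_D}\times(S_{\mathcal{I}_{D^C}})^{\mathcal{I}_D}$, where $(S_{\mathcal{I}_{D^C}})^{\mathcal{I}_D}$ is the set of all functions $\mathcal{I}_D\to S_{\mathcal{I}_{D^C}}$, regarded as a subgroup of $S_{\mathcal{I}}$ via the action in which $g=(h,\tilde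 h)$ sends $\mathbf{i}$ to the cell $g\mathbf{i}$ with $(g\mathbf{i})_D=h\,\mathbf{i}_D$ and $(g\mathbf{i})_{D^C}=\tilde h(\mathbf{i}_D)\,\mathbf{i}_{D^C}$. *)

(* Defs.v *)
From HB Require Import structures.
From mathcomp Require Import all_boot all_order all_algebra all_fingroup.

Set Implicit Arguments.
Unset Strict Implicit.
Unset Printing Implicit Defensive.

Import GRing.Theory.
Local Open Scope ring_scope.

(* [m] is 'I_m, and the j-th set of levels is 'I_(I j): both are numbered from
   0. *)

Definition cell (m : nat) (I : 'I_m -> nat) : finType :=
  {dffun forall j : 'I_m, 'I_(I j)}.

Definition subcell (m : nat) (I : 'I_m -> nat) (D : {set 'I_m}) : finType :=
  {dffun forall j : {j : 'I_m | j \in D}, 'I_(I (val j))}.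

Definition restr (m : nat) (I : 'I_m -> nat) (D : {set 'I_m}) (i : cell I) :
  subcell I D := [ffun j : {j : 'I_m | j \in D} => i (val j)].

(* The void complex set0 is allowed, besides [set set0]. *)
Definition simplicial_complex (m : nat) (Delta : {set {set 'I_m}}) : Prop :=
  forall D E : {set 'I_m}, D \in Delta -> E \subset D -> E \in Delta.

Definition facets (m : nat) (Delta : {set {set 'I_m}}) : {set {set 'I_m}} :=
  [set D | maxset (fun E => E \in Delta) D].

Definition row_index (m : nat) (I : 'I_m -> nat) (Delta : {set {set 'I_m}}) :
  finType := {D : {D | D \in facets Delta} & subcell I (val D)}.

Definition confmx (m : nat) (I : 'I_m -> nat) (Delta : {set {set 'I_m}})
    (r : row_index I Delta) (i : cell I) : rat :=
  (restr (val (tag r)) i == tagged r)%:R.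

(* rat^o is rat, seen as a vector space over itself. *)
Notation ratvec T := {ffun T -> rat^o}.

Definition confmap (m : nat) (I : 'I_m -> nat) (Delta : {set {set 'I_m}})
    (y : ratvec (cell I)) : ratvec (row_index I Delta) :=
  [ffun r => \sum_(i : cell I) confmx r i * y i].

Lemma confmap_is_linear (m : nat) (I : 'I_m -> nat)
  (Delta : {set {set 'I_m}}) : linear (@confmap m I Delta).
Proof.
move=> a y z; apply/ffunP=> r; rewrite !ffunE scaler_sumr -big_split /=.
by apply: eq_bigr => i _; rewrite !ffunE mulrDr; congr (_ + _); apply: mulrCA.
Qed.

HB.instance Definition _ (m : nat) (I : 'I_m -> nat)
    (Delta : {set {set 'I_m}}) :=
  GRing.isLinear.Build rat (ratvec (cell I)) (ratvec (row_index I Delta)) _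
    (@confmap m I Delta) (@confmap_is_linear m I Delta).

Definition ker_conf (m : nat) (I : 'I_m -> nat) (Delta : {set {set 'I_m}}) :
  {vspace ratvec (cell I)} := lker (linfun (@confmap m I Delta)).

Definition permvec (T : finType) (g : {perm T}) (y : ratvec T) : ratvec T :=
  [ffun i => y ((g^-1)%g i)].

Lemma permvec_is_linear (T : finType) (g : {perm T}) : linear (permvec g).
Proof. by move=> a y z; apply/ffunP=> i; rewrite !ffunE. Qed.

HB.instance Definition _ (T : finType) (g : {perm T}) :=
  GRing.isLinear.Build rat (ratvec T) (ratvec T) _
    (permvec g) (permvec_is_linear g).

Definition setwise_stab (T : finType) (L : {vspace ratvec T}) :
  {set {perm T}} := [set g | (linfun (permvec g) @: L)%VS == L].

Definition invariance_group (m : nat) (I : 'I_m -> nat)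
  (Delta : {set {set 'I_m}}) : {set {perm (cell I)}} :=
  setwise_stab (ker_conf I Delta).

Definition wreath (m : nat) (I : 'I_m -> nat) (D : {set 'I_m}) : finType :=
  ({perm subcell I D} * {ffun subcell I D -> {perm subcell I (~: D)}})%type.

(* The image of the wreath product in the symmetric group on the cells: a cell
   is determined by its restrictions to D and to ~: D, so each w is carried by
   exactly one permutation g. *)
Definition wreath_perms (m : nat) (I : 'I_m -> nat) (D : {set 'I_m}) :
  {set {perm (cell I)}} :=
  [set g : {perm (cell I)} | [exists w : wreath I D, [forall i : cell I,
     (restr D (g i) == w.1 (restr D i)) &&
     (restr (~: D) (g i) == w.2 (restr D i) (restr (~: D) i))]]].

(* Main.v *)
Require Import Defs.
From mathcomp Require Import all_boot all_order all_algebra all_fingroup.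
From mathcomp Require Import zify.

Set Implicit Arguments.
Unset Strict Implicit.
Unset Printing Implicit Defensive.

Import Order.TTheory GRing.Theory Num.Theory.
Local Open Scope ring_scope.

(** Let [g] preserve the kernel.  It has to be shown that [g] maps fibres of
    [restr D] into fibres of [restr D], for every facet [D]; this is membership
    in the wreath product ([wreathP]).  The facets are treated by decreasing
    [#|subcell I D|], that is by increasing size of their fibres, so that [g] is
    known to permute the fibres of every facet with more subcells than [D].

    The tool is the kernel [slice E p q].  As a function of [q] it lives on the
    cells that agree with [p] off [E], and its sum over the levels of any single
    coordinate of [E] vanishes; hence it lies in the kernel of the model as soon
    as [E] is contained in no facet ([slice_margin_free]).  As a function of [p]
    it reads off, from a set [S] of cells, the top interaction on [E] inside each
    slice of [S] parallel to [E].

    Let [F] be a fibre of [D] and [S] its image by [g].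
    - If [E] lies in no facet, the sums of [slice E p] over [S] vanish, because
      those of the kernel elements over [F] do and [g] preserves the kernel.
    - Some such sum is nonzero for an [E] that lies in no facet with more
      subcells than [D].  Otherwise the indicator of [S] would be a combination
      of functions of the restrictions to those larger facets, hence orthogonal
      to everything with vanishing margins on them ([sum_margin_free]).  But
      [slice D x], for [x] in [F], transported by [g] is such a function, and its
      sum over [S] is the sum of [slice D x] over [F], which is not zero.
    Take [E] maximal with this property.  Then the sum of [slice E p] over [S]
    does not depend on the coordinates of [p] off [E] ([sum_slice_indep]), so
    [S] meets every slice parallel to [E] and has at least as many elements as
    there are slices.  Comparing with the size of [S] and using that facets have
    distinct numbers of subcells, [E] must be [D], and [S] has exactly one point
    in each slice.  The value of the sum then is a product of contrasts which
    determines that point within its slice, since at most one coordinate is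
    binary ([prod_contrast_inj]); being the same in all slices, the point has
    constant restriction to [D].  This is [fibre_recognition].

    Conversely a permutation which permutes the fibres of all facets permutes the
    margins of any function, hence preserves the kernel. *)

(** * Restrictions of cells *)

Lemma restr_eqP (m : nat) (I : 'I_m -> nat) (D : {set 'I_m}) (p q : cell I) :
  reflect {in D, forall j, p j = q j} (restr D p == restr D q).
Proof.
apply: (iffP eqP) => [/ffunP eq_pq j jD | eq_pq].
  by have := eq_pq (Sub j jD); rewrite !ffunE.
by apply/ffunP=> j; rewrite !ffunE; apply/eq_pq/valP.
Qed.

Lemma eq_restr_sub (m : nat) (I : 'I_m -> nat) (D E : {set 'I_m})
    (p q : cell I) :
  E \subset D -> restr D p = restr D q -> restr E p = restr E q.
Proof.
move=> /subsetP sED /eqP/restr_eqP eq_pq; apply/eqP/restr_eqP=> j /sED.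
exact: eq_pq.
Qed.

Definition mix (m : nat) (I : 'I_m -> nat) (D : {set 'I_m}) (p q : cell I) :
  cell I := [ffun j => if j \in D then p j else q j].

Lemma restr_mix (m : nat) (I : 'I_m -> nat) (D : {set 'I_m}) (p q : cell I) :
  restr D (mix D p q) = restr D p.
Proof. by apply/eqP/restr_eqP=> j jD; rewrite ffunE jD. Qed.

Lemma restr_mixC (m : nat) (I : 'I_m -> nat) (D : {set 'I_m}) (p q : cell I) :
  restr (~: D) (mix D p q) = restr (~: D) q.
Proof.
by apply/eqP/restr_eqP=> j; rewrite inE ffunE => /negbTE->.
Qed.

Lemma restr_inj (m : nat) (I : 'I_m -> nat) (D : {set 'I_m}) (p q : cell I) :
  restr D p = restr D q -> restr (~: D) p = restr (~: D) q -> p = q.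
Proof.
move=> /eqP/restr_eqP eqD /eqP/restr_eqP eqDC; apply/ffunP=> j.
by case: (boolP (j \in D)) => [/eqD // | jD]; apply: eqDC; rewrite inE.
Qed.


Lemma restr_surj (m : nat) (I : 'I_m -> nat) (D : {set 'I_m})
    (I_ge2 : forall j : 'I_m, (2 <= I j)%N) (u : subcell I D) :
  exists p : cell I, restr D p = u.
Proof.
exists [ffun j : 'I_m => match (j \in D) =P true with
  | ReflectT jD => u (exist _ j jD)
  | ReflectF _ => Ordinal (ltnW (I_ge2 j)) end].
apply/ffunP=> -[j jD]; rewrite !ffunE /=.
by case: eqP => // jD'; rewrite (bool_irrelevance jD' jD).
Qed.

Lemma card_subcell (m : nat) (I : 'I_m -> nat) (D : {set 'I_m}) :
  #|subcell I D| = (\prod_(j in D) I j)%N.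
Proof.
rewrite card_dep_ffun foldrE big_image [RHS]big_sub /=.
by apply: eq_bigr => j _; rewrite card_ord.
Qed.

Lemma card_subcellC (m : nat) (I : 'I_m -> nat) (D : {set 'I_m}) :
  (#|subcell I D| * #|subcell I (~: D)|)%N = (\prod_j I j)%N.
Proof.
rewrite !card_subcell [RHS](bigID (mem D)) /=.
by congr (_ * _)%N; apply: eq_bigl => j; rewrite inE.
Qed.

Lemma card_subcell_proper (m : nat) (I : 'I_m -> nat) (D E : {set 'I_m})
    (I_ge2 : forall j : 'I_m, (2 <= I j)%N) :
  E \proper D -> (#|subcell I E| < #|subcell I D|)%N.
Proof.
have prod_gt0 (A : {set 'I_m}) : (0 < \prod_(j in A) I j)%N.
  by apply: prodn_gt0 => j; apply: ltnW.
case/properP=> sED [j jD jE]; rewrite !card_subcell [ltnRHS](big_setID E) /=.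
rewrite (setIidPr sED) ltn_Pmulr //.
rewrite (big_setD1 j) /=; last by rewrite inE jD jE.
by apply: leq_trans (I_ge2 j) _; rewrite leq_pmulr.
Qed.

Lemma card_fibre (m : nat) (I : 'I_m -> nat) (D : {set 'I_m})
    (I_ge2 : forall j : 'I_m, (2 <= I j)%N) (u : subcell I D) :
  #|[set p | restr D p == u]| = #|subcell I (~: D)|.
Proof.
rewrite -(@card_in_imset _ _ (restr (~: D))); last first.
  move=> p q; rewrite !inE => /eqP pu /eqP qu; apply: restr_inj.
  by rewrite pu qu.
apply: eq_card => v; rewrite [RHS]inE; apply/imsetP.
have [p pu] := restr_surj I_ge2 u; have [q qv] := restr_surj I_ge2 v.
by exists (mix D p q); rewrite ?inE ?restr_mix ?restr_mixC ?pu.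
Qed.

(** * Interaction kernels *)

(** Up to the factor [n], the kernel of the orthogonal projection of the
    functions of one coordinate with [n] levels onto those of zero sum. *)
Definition contrast (n : nat) (a b : 'I_n) : rat := n%:R * (a == b)%:R - 1.

(** Contrasts on [E] and the identity elsewhere: this kernel acts on each slice
    parallel to [E] separately. *)
Definition slice (m : nat) (I : 'I_m -> nat) (E : {set 'I_m}) (p q : cell I) :
  rat := \prod_j (if j \in E then contrast (p j) (q j) else (p j == q j)%:R).

(** Contrasts on [E] and summation elsewhere: up to a scalar, the orthogonal
    projection onto the interaction space of [E] in the space of all functions
    on the cells. *)
Definition interaction (m : nat) (I : 'I_m -> nat) (E : {set 'I_m})
    (p q : cell I) : rat :=
  \prod_j (if j \in E then contrast (p j) (q j) else 1).

Lemma sum_contrast (n : nat) (a : 'I_n) : \sum_b contrast a b = 0.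
Proof.
rewrite /contrast sumrB -mulr_sumr sumr_const card_ord.
rewrite (bigD1 a) //= eqxx big1 ?addr0 ?mulr1 ?subrr // => b.
by rewrite eq_sym => /negbTE->.
Qed.

Lemma slice_neq0 (m : nat) (I : 'I_m -> nat) (E : {set 'I_m}) (p q : cell I) :
  slice E p q != 0 -> restr (~: E) p = restr (~: E) q.
Proof.
move=> nz; apply/eqP/restr_eqP => j; rewrite inE => /negbTE jE.
move: nz; rewrite /slice (bigD1 j) //= jE.
by case: (p j =P q j) => // _; rewrite mul0r eqxx.
Qed.

Lemma slice_same (m : nat) (I : 'I_m -> nat) (E : {set 'I_m}) (p q : cell I) :
  restr (~: E) p = restr (~: E) q ->
  slice E p q = \prod_(j in E) contrast (p j) (q j).
Proof.
move=> /eqP/restr_eqP eqpq; rewrite [RHS]big_mkcond /slice.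
apply: eq_bigr => j _; case: ifP => // jE.
by rewrite eqpq ?eqxx // inE jE.
Qed.

(** A coordinate [j] in [E] but not in [D] varies freely inside the fibre, and
    the contrasts at [j] sum to zero.  To sum over [j] first, the sum is extended
    to pairs of a cell and a level of [j], on which exchanging this level with
    the [j]-coordinate of the cell is an involution. *)
Lemma sum_fibre_slice (m : nat) (I : 'I_m -> nat) (D E : {set 'I_m})
    (p : cell I) (u : subcell I D) :
  ~~ (E \subset D) -> \sum_(q | restr D q == u) slice E p q = 0.
Proof.
case/subsetPn=> j jE jD.
pose upd (q : cell I) (v : 'I_(I j)) : cell I := [ffun k => dfwith q v k].
have upd_in q v : upd q v j = v by rewrite ffunE dfwith_in.
have upd_out q v k : j != k -> upd q v k = q k.
  by move=> jk; rewrite ffunE dfwith_out.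
have updK q v : upd (upd q v) (q j) = q.
  by apply/ffunP=> k; have [<-|jk] := eqVneq j k; rewrite ?upd_in ?upd_out.
have upd_D q v : restr D (upd q v) = restr D q.
  apply/eqP/restr_eqP=> k kD; rewrite upd_out //.
  by apply: contraNneq jD => ->.
have Ij0 : (I j)%:R != 0 :> rat.
  by rewrite pnatr_eq0 -lt0n; apply: leq_ltn_trans (ltn_ord (p j)).
apply: (mulfI Ij0); rewrite mulr0.
pose swap (x : cell I * 'I_(I j)) := (upd x.1 x.2, x.1 j).
have swapK : involutive swap by case=> q v; rewrite /swap /= updK upd_in.
transitivity (\sum_(x : cell I * 'I_(I j) | (restr D x.1 == u) && true)
                 slice E p x.1).
  rewrite -(pair_big_dep (fun q => restr D q == u) (fun _ _ => true)
    (fun q _ => slice E p q)) /= mulr_sumr.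
  by apply: eq_bigr => q _; rewrite sumr_const card_ord mulr_natl.
rewrite (reindex_inj (inv_inj swapK)) /=.
under eq_bigl => x do rewrite upd_D.
rewrite -(pair_big_dep (fun q => restr D q == u) (fun _ _ => true)
    (fun q v => slice E p (upd q v))) /=.
apply: big1 => q _.
under eq_bigr => v _.
  rewrite /slice (bigD1 j) //= jE upd_in.
  under eq_bigr => k kj do rewrite upd_out 1?eq_sym //.
  over.
by rewrite -mulr_suml sum_contrast mul0r.
Qed.

(** Expanding the product over the coordinates of [contrast + 1], which is the
    identity kernel up to the number of levels: this is the decomposition of the
    space of functions into interactions. *)
Lemma sum_interaction (m : nat) (I : 'I_m -> nat) (p q : cell I) :
  \sum_(E : {set 'I_m}) interaction E p q = (\prod_j (I j)%:R) * (p == q)%:R.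
Proof.
rewrite /interaction -bigA_distr /=.
under eq_bigr => j _ do rewrite /contrast subrK.
have [<-|neq] := eqVneq p q.
  by rewrite mulr1; apply: eq_bigr => j _; rewrite eqxx mulr1.
have [j pj] : exists j, p j != q j.
  by apply/existsP; apply: contraNT neq => /existsPn E; apply/eqP/ffunP=> j;
     apply/eqP/negPn/E.
by rewrite (bigD1 j) //= (negbTE pj) !mulr0 mul0r.
Qed.

Lemma interaction_restr (m : nat) (I : 'I_m -> nat) (E : {set 'I_m})
    (p p' q : cell I) :
  restr E p = restr E p' -> interaction E p q = interaction E p' q.
Proof.
move=> /eqP/restr_eqP eqp; apply: eq_bigr => j _.
by case: ifP => // jE; rewrite eqp.
Qed.

(** Only the mixture of [p] and [q] contributes, as the unique cell of its slice
    with the given restriction to [E]. *)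
Lemma sum_slice (m : nat) (I : 'I_m -> nat) (E : {set 'I_m}) (p q : cell I) :
  \sum_(p' | restr E p' == restr E p) slice E p' q = interaction E p q.
Proof.
rewrite (bigD1 (mix E p q)) ?restr_mix //= big1 ?addr0 => [|p'].
  rewrite slice_same ?restr_mixC // /interaction [LHS]big_mkcond.
  by apply: eq_bigr => j _; rewrite ffunE; case: (j \in E).
case/andP=> /eqP eqE; apply: contraNeq => /slice_neq0 eqEC.
by apply/eqP/(@restr_inj _ _ E); rewrite ?restr_mix ?restr_mixC.
Qed.

(** * Functions with vanishing margins *)

Definition margin_free (m : nat) (I : 'I_m -> nat) (Gamma : {set {set 'I_m}})
    (y : cell I -> rat) : Prop :=
  forall D, D \in Gamma ->
  forall u : subcell I D, \sum_(p | restr D p == u) y p = 0.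

Lemma slice_margin_free (m : nat) (I : 'I_m -> nat) (Gamma : {set {set 'I_m}})
    (E : {set 'I_m}) (p : cell I) :
  {in Gamma, forall D : {set 'I_m}, ~~ (E \subset D)} ->
  margin_free Gamma (slice E p).
Proof. by move=> notE D DG u; apply: sum_fibre_slice (notE D DG). Qed.

(** The hypothesis on [S] says that its indicator has no interaction outside the
    subsets of the members of [Gamma], so that it is a sum of functions of the
    restrictions to these; functions with vanishing [Gamma]-margins are orthogonal
    to all of them. *)
Lemma sum_margin_free (m : nat) (I : 'I_m -> nat) (Gamma : {set {set 'I_m}})
    (S : {set cell I}) (w : cell I -> rat)
    (I_ge2 : forall j : 'I_m, (2 <= I j)%N) :
  (forall E : {set 'I_m}, {in Gamma, forall D : {set 'I_m}, ~~ (E \subset D)} ->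
     forall p, \sum_(q in S) slice E p q = 0) ->
  margin_free Gamma w -> \sum_(q in S) w q = 0.
Proof.
move=> noE w0.
have N0 : \prod_j (I j)%:R != 0 :> rat.
  by apply/prodf_neq0 => j _; rewrite pnatr_eq0 -lt0n; apply: ltnW.
apply: (mulfI N0); rewrite mulr0 mulr_sumr.
transitivity (\sum_(q in S) \sum_p \sum_(E : {set 'I_m})
                w p * interaction E p q).
  apply: eq_bigr => q _.
  under [RHS]eq_bigr => p _ do rewrite -mulr_sumr sum_interaction.
  rewrite (bigD1 q) //= eqxx mulr1 [X in _ + X]big1 ?addr0 1?mulrC // => p.
  by move=> /negbTE->; rewrite !mulr0.
under eq_bigr => q _ do rewrite exchange_big /=.
rewrite exchange_big big1 //= => E _.
have [/existsP[D /andP[DG sED]] | /existsPn notE] :=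
  boolP [exists D, (D \in Gamma) && (E \subset D)].
  apply: big1 => q _.
  rewrite (partition_big (restr D) predT) //= big1 // => u _.
  have [p0 <-] := restr_surj I_ge2 u.
  rewrite (eq_bigr (fun p => w p * interaction E p0 q)).
    by rewrite -mulr_suml w0 // mul0r.
  by move=> p /eqP /(eq_restr_sub sED) /interaction_restr->.
rewrite exchange_big big1 //= => p _; rewrite -mulr_sumr.
under eq_bigr => q _ do rewrite -sum_slice.
rewrite exchange_big big1 ?mulr0 //= => p' _; apply: noE => D DG.
by have := notE D; rewrite DG.
Qed.

(** * Recognizing fibres *)

(** The contrast at [j] is [I j] times the identity minus the summation over the
    levels of [j].  So [I j] times [slice E] is the sum of [slice (j |: E)], which
    contributes zero, and of a kernel that does not involve [p j]. *)
Lemma sum_slice_indep1 (m : nat) (I : 'I_m -> nat) (E : {set 'I_m})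
    (S : {set cell I}) (j : 'I_m) (p p' : cell I) :
  j \notin E -> (forall p, \sum_(q in S) slice (j |: E) p q = 0) ->
  (forall k, k != j -> p k = p' k) ->
  \sum_(q in S) slice E p q = \sum_(q in S) slice E p' q.
Proof.
move=> jE top0 eqp.
have Ij0 : (I j)%:R != 0 :> rat.
  by rewrite pnatr_eq0 -lt0n; apply: leq_ltn_trans (ltn_ord (p j)).
pose rest (p q : cell I) : rat :=
  \prod_(k | k != j) (if k \in E then contrast (p k) (q k) else (p k == q k)%:R).
have restE r : (I j)%:R * \sum_(q in S) slice E r q = \sum_(q in S) rest r q.
  rewrite -[RHS]add0r -[X in X + _](top0 r) -big_split mulr_sumr.
  apply: eq_bigr => q _.
  rewrite /= /slice (bigD1 j) //= (negbTE jE) [in RHS](bigD1 j) //= setU11.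
  rewrite [X in contrast _ _ * X](_ : _ = rest r q); last first.
    by apply: eq_bigr => k /negbTE kj; rewrite !inE kj.
  by rewrite -/(rest r q) /contrast mulrBl mul1r subrK mulrA.
apply: (mulfI Ij0); rewrite !restE; apply: eq_bigr => q _.
by apply: eq_bigr => k kj; rewrite eqp.
Qed.

Lemma sum_slice_indep (m : nat) (I : 'I_m -> nat) (E : {set 'I_m})
    (S : {set cell I}) (p p' : cell I) :
  (forall j, j \notin E -> forall p, \sum_(q in S) slice (j |: E) p q = 0) ->
  restr E p = restr E p' ->
  \sum_(q in S) slice E p q = \sum_(q in S) slice E p' q.
Proof.
move=> top0; have [n] := ubnP #|[set j | p j != p' j]|.
elim: n p => // n IHn p le_n eqE.
have [/eqP-> // | /eqP neq] := eqVneq (p == p') true.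
have [j pj] : exists j, p j != p' j.
  apply/existsP; apply: contra_notT neq => /existsPn E0.
  by apply/eqP/ffunP=> j; apply/eqP/negPn/E0.
have jE : j \notin E.
  by apply: contra pj => jE; move/eqP/restr_eqP: eqE => ->.
pose p1 := mix [set j] p' p.
transitivity (\sum_(q in S) slice E p1 q).
  apply: (@sum_slice_indep1 _ _ _ _ j) => // [|k kj]; first exact: top0.
  by rewrite ffunE inE (negbTE kj).
apply: IHn.
  rewrite -ltnS; apply: leq_trans le_n; rewrite ltnS; apply: proper_card.
  apply/properP; split; last by exists j; rewrite !inE // ffunE inE !eqxx.
  by apply/subsetP=> k; rewrite !inE ffunE inE; case: ifP => // _; rewrite eqxx.
rewrite -eqE; apply/eqP/restr_eqP => k kE; rewrite ffunE inE.
by case: eqP => // kj; rewrite -kj kE in jE.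
Qed.

Lemma contrast_id (n : nat) (a : 'I_n) : contrast a a = n%:R - 1.
Proof. by rewrite /contrast eqxx mulr1. Qed.

Lemma contrast_neq (n : nat) (a b : 'I_n) : a != b -> contrast a b = -1.
Proof. by rewrite /contrast => /negbTE->; rewrite mulr0 add0r. Qed.

(** The product on the right is the value of the left one at [q = p].  A
    disagreement in a coordinate with more than two levels makes the product
    strictly smaller in absolute value; if the only disagreement is in the one
    binary coordinate, where the contrasts are [1] and [-1], the product changes
    sign.  With two binary coordinates the signs could cancel. *)
Lemma prod_contrast_inj (m : nat) (I : 'I_m -> nat) (D : {set 'I_m})
    (p q : cell I) (I_ge2 : forall j : 'I_m, (2 <= I j)%N)
    (I_gt2 : (#|[set j : 'I_m | ~~ (2 < I j)%N]| <= 1)%N) :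
  \prod_(j in D) contrast (p j) (q j) = \prod_(j in D) ((I j)%:R - 1) ->
  restr D p = restr D q.
Proof.
have n_ge1 j : 1 <= (I j)%:R - 1 :> rat by rewrite lerBrDr (ler_nat _ 2).
have n_ge0 j : 0 <= (I j)%:R - 1 :> rat := le_trans ler01 (n_ge1 j).
have normc j : `|contrast (p j) (q j)| <= (I j)%:R - 1.
  have [->|/contrast_neq->] := eqVneq (p j) (q j).
    by rewrite contrast_id ger0_norm.
  by rewrite normrN1.
move=> eq_prod; apply/eqP/restr_eqP => k kD; apply/eqP.
apply: contraT => pqk.
have [/exists_inP[j jD /andP[pqj Ij]] | /exists_inPn small] :=
  boolP [exists j in D, (p j != q j) && (2 < I j)%N].
  (* Disagreement at [j] with more than two levels: compare absolute values. *)
  suff: `|\prod_(j in D) contrast (p j) (q j)| <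
        \prod_(j in D) ((I j)%:R - 1 : rat).
    by rewrite eq_prod ger0_norm ?ltxx // prodr_ge0.
  rewrite normr_prod !(bigD1 j jD) /= contrast_neq // normrN1 mul1r.
  apply: (@le_lt_trans _ _ (\prod_(i in D | i != j) ((I i)%:R - 1 : rat))).
    by apply: ler_prod => i _; rewrite normr_ge0 normc.
  rewrite ltr_pMl; first by rewrite ltrBrDr (ltr_nat _ 2).
  by apply: prodr_gt0 => i _; apply: lt_le_trans ltr01 (n_ge1 i).
(* Otherwise [k] is the only disagreement: compare signs. *)
have le2 j : j \in D -> p j != q j -> j \in [set j : 'I_m | ~~ (2 < I j)%N].
  by move=> jD pqj; rewrite inE; have := small j jD; rewrite pqj.
move: eq_prod; rewrite !(bigD1 k kD) /= contrast_neq //.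
rewrite (eq_bigr (fun j => (I j)%:R - 1 : rat)); last first.
  move=> j /andP[jD jk]; have [->|pqj] := eqVneq (p j) (q j).
    exact: contrast_id.
  by move: jk; rewrite (card_le1_eqP I_gt2 k j) ?eqxx ?le2.
have rest_gt0 : 0 < \prod_(j in D | j != k) ((I j)%:R - 1 : rat).
  by apply: prodr_gt0 => i _; apply: lt_le_trans ltr01 (n_ge1 i).
by move/(mulIf (lt0r_neq0 rest_gt0)) => eqk; have := n_ge1 k; rewrite -eqk.
Qed.

(** The support [E] of a top interaction of [S] gives the lower bound
    [#|subcell I (~: E)|] for [#|S|], one point for each slice.  The last two
    hypotheses make this bound tight: [E] is forced to be [D], every slice has
    exactly one point, and this point is the same in all slices. *)
Lemma fibre_recognition (m : nat) (I : 'I_m -> nat) (Fs : {set {set 'I_m}})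
    (D : {set 'I_m}) (S : {set cell I})
    (I_ge2 : forall j : 'I_m, (2 <= I j)%N)
    (I_gt2 : (#|[set j : 'I_m | ~~ (2 < I j)%N]| <= 1)%N) :
  {in Fs &, injective (fun D : {set 'I_m} => #|subcell I D|)} ->
  D \in Fs ->
  (forall E : {set 'I_m}, {in Fs, forall D' : {set 'I_m}, ~~ (E \subset D')} ->
     forall p, \sum_(q in S) slice E p q = 0) ->
  (exists E : {set 'I_m}, exists p,
     {in Fs, forall D' : {set 'I_m}, (#|subcell I D| < #|subcell I D'|)%N ->
        ~~ (E \subset D')} /\ \sum_(q in S) slice E p q != 0) ->
  #|S| = #|subcell I (~: D)| ->
  {in S &, forall q q' : cell I, restr D q = restr D q'}.
Proof.
move=> card_inj DF S0 [E0 [p0 [notE0 nzE0]]] cardS.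
pose big_out (E : {set 'I_m}) := [forall D' in Fs,
  (#|subcell I D| < #|subcell I D'|)%N ==> ~~ (E \subset D')].
pose visible E := big_out E && [exists p, \sum_(q in S) slice E p q != 0].
have visE0 : visible E0.
  apply/andP; split; last by apply/existsP; exists p0.
  by apply/forall_inP=> D' D'F; apply/implyP; apply: notE0.
have [E /maxsetP[/andP[/forall_inP outE /existsP[p nzE]] maxE] _] :=
  maxset_exists visE0.
have top0 j : j \notin E -> forall p, \sum_(q in S) slice (j |: E) p q = 0.
  move=> jE p1; apply: contraNeq jE => nz1.
  suff <- : j |: E = E by rewrite setU11.
  apply: maxE; last exact: subsetUr.
  apply/andP; split; last by apply/existsP; exists p1.
  apply/forall_inP=> D' D'F; apply/implyP => /(implyP (outE D' D'F)).
  by apply: contra => /(subset_trans (subsetUr _ _)).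
have indep p1 : restr E p1 = restr E p ->
    \sum_(q in S) slice E p1 q = \sum_(q in S) slice E p q.
  exact: sum_slice_indep.
have meets : restr (~: E) @: S = [set: subcell I (~: E)].
  apply/setP=> v; rewrite inE; have [p1 <-] := restr_surj I_ge2 v.
  have : \sum_(q in S) slice E (mix E p p1) q != 0.
    by rewrite indep // restr_mix.
  apply: contraNT => /imsetP no; apply/eqP/big1 => q qS.
  apply/eqP; apply: contraT => /slice_neq0; rewrite restr_mixC => eqq.
  by case: no; exists q.
have leE : (#|subcell I (~: E)| <= #|subcell I (~: D)|)%N.
  by rewrite -cardS -[leqLHS]cardsT -meets leq_imset_card.
have geE : (#|subcell I D| <= #|subcell I E|)%N.
  have := card_subcellC I D; rewrite -(card_subcellC I E).
  have : (0 < #|subcell I (~: D)|)%N.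
    by rewrite card_subcell prodn_gt0 // => j; apply: ltnW.
  nia.
(* Every facet containing [E] has at most as many subcells as [D], so that
   [geE] leaves only [D] itself. *)
have [D' D'F sED'] : exists2 D' : {set 'I_m}, D' \in Fs & E \subset D'.
  apply/exists_inP; apply: contraNT nzE => /exists_inPn noE.
  by rewrite S0.
have D'_small : (#|subcell I D'| <= #|subcell I D|)%N.
  by rewrite leqNgt; apply: contraL sED' => /(implyP (outE D' D'F)).
have eqE : E = D'.
  apply: contraTeq (leq_trans D'_small geE) => neq.
  by rewrite -ltnNge card_subcell_proper // properEneq neq.
have eqD : D' = D.
  by apply: card_inj => //; apply/anti_leq; rewrite D'_small -eqE.
rewrite {}eqE {}eqD in top0 meets.
have inj : {in S &, injective (restr (~: D))}.
  by apply/imset_injP; rewrite meets cardsT cardS.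
(* As [S] meets each slice once, its sums of [slice D] have a single term. *)
have value q : q \in S -> forall p1, restr (~: D) p1 = restr (~: D) q ->
    \sum_(r in S) slice D p1 r = \prod_(j in D) contrast (p1 j) (q j).
  move=> qS p1 eqp1; rewrite (bigD1 q) //= slice_same //.
  rewrite [X in _ + X]big1 ?addr0 // => r.
  case/andP=> rS; apply: contraNeq => /slice_neq0; rewrite eqp1 => eqr.
  by apply/eqP/inj.
have indepD p1 p2 : restr D p1 = restr D p2 ->
    \sum_(r in S) slice D p1 r = \sum_(r in S) slice D p2 r.
  exact: sum_slice_indep.
move=> q q' qS q'S; rewrite -(restr_mix D q q').
apply: prod_contrast_inj => //.
(* The sum at [mix D q q'] is the product comparing [q] with [q'], read in the
   slice of [q']; moved to the slice of [q], it compares [q] with itself. *)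
rewrite -(value q' q'S) ?restr_mixC // (indepD _ q) ?restr_mix // (value q) //.
by apply: eq_bigr => j _; rewrite contrast_id.
Qed.

(** * Permutations preserving the kernel *)

Lemma ker_confP (m : nat) (I : 'I_m -> nat) (Delta : {set {set 'I_m}})
    (y : ratvec (cell I)) :
  reflect (margin_free (facets Delta) y) (y \in ker_conf I Delta).
Proof.
have marginE (r : row_index I Delta) : confmap Delta y r =
    \sum_(i | restr (val (tag r)) i == tagged r) y i.
  rewrite ffunE [RHS]big_mkcond; apply: eq_bigr => i _; rewrite /confmx.
  by case: eqP => _; rewrite ?mul1r ?mul0r.
rewrite /ker_conf memv_ker lfunE /=.
apply: (iffP eqP) => [y0 D DF u | y0].
  pose r : row_index I Delta := Tagged (fun D => subcell I (val D))
     (u : subcell I (val (exist _ D DF : {D | D \in facets Delta}))).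
  by have := marginE r; rewrite y0 ffunE.
by apply/ffunP=> r; rewrite marginE ffunE; apply/y0/valP.
Qed.

(** A map that sends fibres into fibres induces a map [h] on the subcells, which
    is onto because [g] is, hence a permutation; the restriction of [g] to one
    fibre, read in the complementary coordinates, is injective because [g] is. *)
Lemma wreathP (m : nat) (I : 'I_m -> nat) (D : {set 'I_m})
    (g : {perm (cell I)}) (I_ge2 : forall j : 'I_m, (2 <= I j)%N) :
  reflect (forall p q, restr D p = restr D q -> restr D (g p) = restr D (g q))
    (g \in wreath_perms I D).
Proof.
rewrite inE; apply: (iffP existsP) => [[[h k] /forallP/= gE] p q eqpq | fib].
  by have /andP[/eqP-> _] := gE p; have /andP[/eqP-> _] := gE q; rewrite eqpq.
have cell0 : cell I by exact: [ffun j => Ordinal (ltnW (I_ge2 j))].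
(* [cell0] only fills the default of [odflt]: every subcell has a preimage. *)
pose rep (E : {set 'I_m}) (u : subcell I E) :=
  odflt cell0 [pick p | restr E p == u].
have repK (E : {set 'I_m}) (u : subcell I E) : restr E (rep E u) = u.
  rewrite /rep; case: pickP => [p /eqP // | no].
  by have [p pu] := restr_surj I_ge2 u; have := no p; rewrite pu eqxx.
pose h u := restr D (g (rep D u)).
have hE p : restr D (g p) = h (restr D p) by apply: fib; rewrite repK.
have h_inj : injective h.
  pose r u := restr D (g^-1%g (rep D u)).
  have rK : cancel r h by move=> u; rewrite /r -hE permKV repK.
  exact: (bij_inj (bij_can_bij (injF_bij (can_inj rK)) rK)).
pose k u v := restr (~: D) (g (mix D (rep D u) (rep (~: D) v))).
have k_inj u : injective (k u).
  move=> v v' eqk; rewrite -[v]repK -[v']repK.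
  rewrite -(restr_mixC D (rep D u)) -(restr_mixC D (rep D u) (rep _ v')).
  congr restr; apply/(@perm_inj _ g)/(@restr_inj _ _ D) => //.
  by rewrite !hE !restr_mix.
exists (perm h_inj, [ffun u => perm (k_inj u)]); apply/forallP=> p /=.
rewrite permE -hE eqxx ffunE permE /k; apply/eqP; congr (restr _ (g _)).
by apply: (@restr_inj _ _ D); rewrite ?restr_mix ?restr_mixC repK.
Qed.

Lemma wreath_perms_inv (m : nat) (I : 'I_m -> nat) (D : {set 'I_m})
    (g : {perm (cell I)}) (I_ge2 : forall j : 'I_m, (2 <= I j)%N) :
  g \in wreath_perms I D -> g^-1%g \in wreath_perms I D.
Proof.
rewrite inE => /existsP[[h k] /forallP/= gE]; apply/wreathP => // p q eqpq.
apply: (@perm_inj _ h).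
have hE r : h (restr D (g^-1%g r)) = restr D r.
  by have /andP[/eqP<- _] := gE (g^-1%g r); rewrite permKV.
by rewrite !hE.
Qed.

Lemma wreath_margin_free (m : nat) (I : 'I_m -> nat) (Gamma : {set {set 'I_m}})
    (g : {perm (cell I)}) (y : cell I -> rat)
    (I_ge2 : forall j : 'I_m, (2 <= I j)%N) :
  {in Gamma, forall D : {set 'I_m}, g \in wreath_perms I D} ->
  margin_free Gamma y -> margin_free Gamma (fun p => y (g p)).
Proof.
move=> wrg y0 D DG u; have [p0 <-] := restr_surj I_ge2 u.
rewrite -[RHS](y0 D DG (restr D (g p0))) [RHS](reindex_inj (@perm_inj _ g)) /=.
apply: eq_bigl => p; apply/eqP/eqP; first exact: (wreathP _ _ I_ge2 (wrg D DG)).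
move/(wreathP _ _ I_ge2 (wreath_perms_inv I_ge2 (wrg D DG))).
by rewrite !permK.
Qed.

Lemma invariance_margin_free (m : nat) (I : 'I_m -> nat)
    (Delta : {set {set 'I_m}}) (g : {perm (cell I)}) (y : cell I -> rat) :
  g \in invariance_group I Delta -> margin_free (facets Delta) y ->
  margin_free (facets Delta) (fun p => y (g p)).
Proof.
rewrite inE => /eqP stab y0.
pose v : ratvec (cell I) := [ffun p => y p].
have : v \in ker_conf I Delta.
  apply/ker_confP => D DF u; rewrite -[RHS](y0 D DF u).
  by apply: eq_bigr => p _; rewrite ffunE.
rewrite -stab => /memv_imgP[w /ker_confP w0]; rewrite lfunE /= => vE.
move=> D DF u; rewrite -[RHS](w0 D DF u); apply: eq_bigr => p _.
by have /ffunP/(_ (g p)) := vE; rewrite !ffunE permK.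
Qed.

(** Induction along the facets by decreasing number of subcells.  The larger
    facets, whose fibres [g] already permutes, are exactly what is needed to
    transport [slice D x] and detect an interaction of the image of the fibre
    that these facets do not account for. *)
Lemma invariance_fibres (m : nat) (I : 'I_m -> nat) (Delta : {set {set 'I_m}})
    (g : {perm (cell I)})
    (I_ge2 : forall j : 'I_m, (2 <= I j)%N)
    (card_distinct :
       {in facets Delta &, injective (fun D : {set 'I_m} => #|subcell I D|)})
    (I_gt2 : (#|[set j : 'I_m | ~~ (2 < I j)%N]| <= 1)%N) (D : {set 'I_m}) :
  g \in invariance_group I Delta -> D \in facets Delta ->
  g \in wreath_perms I D.
Proof.
move=> gG; have [n] := ubnP (\prod_j I j - #|subcell I D|)%N.
elim: n D => // n IHn D le_n DF.
have bigger D' : D' \in facets Delta -> (#|subcell I D| < #|subcell I D'|)%N ->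
    g \in wreath_perms I D'.
  move=> D'F ltD; apply: IHn => //; rewrite -ltnS; apply: leq_trans le_n.
  rewrite ltnS ltn_sub2l //; apply: leq_trans ltD _.
  by rewrite -(card_subcellC I D') leq_pmulr // card_subcell prodn_gt0 // => j;
    apply: ltnW.
apply/wreathP => // x x' eqx.
pose F := [set p | restr D p == restr D x].
have sum_gF (w : cell I -> rat) :
    \sum_(q in g @: F) w q = \sum_(p in F) w (g p).
  by rewrite big_imset //= => p q _ _ /perm_inj.
apply: (@fibre_recognition _ _ (facets Delta) D (g @: F)) => //.
- move=> E notE p; rewrite sum_gF.
  under eq_bigl => q do rewrite inE.
  exact: (invariance_margin_free gG (slice_margin_free p notE) DF).
- pose Gamma := [set D' in facets Delta | (#|subcell I D| < #|subcell I D'|)%N].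
  have [/existsP[E /existsP[p /andP[/forall_inP notE nz]]] | none] :=
    boolP [exists E : {set 'I_m}, exists p,
      [forall D' in Gamma, ~~ (E \subset D')]
      && (\sum_(q in g @: F) slice E p q != 0)].
    exists E, p; split=> // D' D'F ltD; apply: notE.
    by rewrite inE D'F.
  (* Were there no such [E], [slice D x] transported by [g] would have zero sum
     over the image of the fibre, while only [x] itself contributes to it. *)
  have notD : {in Gamma, forall D' : {set 'I_m}, ~~ (D \subset D')}.
    move=> D'; rewrite inE => /andP[D'F]; apply: contraTN => sDD'.
    suff -> : D = D' by rewrite ltnn.
    move: DF D'F; rewrite !inE => /maxsetP[_ maxD] /maxsetP[D'D _].
    by rewrite (maxD D').
  have wreathV :
      {in Gamma, forall D' : {set 'I_m}, g^-1%g \in wreath_perms I D'}.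
    move=> D'; rewrite inE => /andP[D'F ltD].
    by apply: wreath_perms_inv => //; apply: bigger.
  have noneE (E : {set 'I_m}) :
      {in Gamma, forall D' : {set 'I_m}, ~~ (E \subset D')} ->
      forall p, \sum_(q in g @: F) slice E p q = 0.
    move=> notE p; apply/eqP; apply: contraNT none => nz.
    apply/existsP; exists E; apply/existsP; exists p; rewrite nz andbT.
    exact/forall_inP.
  have := sum_margin_free I_ge2 noneE
    (wreath_margin_free I_ge2 wreathV (slice_margin_free x notD)).
  rewrite sum_gF.
  under eq_bigr => p _ do rewrite permK.
  rewrite (bigD1 x) ?inE //= big1 ?addr0 => [|p]; last first.
    rewrite inE => /andP[/eqP eqpx]; apply: contraNeq => /slice_neq0 eqC.
    by apply/eqP/(restr_inj eqpx).
  rewrite slice_same // => /eqP /prodf_eq0[j _].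
  rewrite contrast_id subr_eq0 (eqr_nat _ _ 1).
  by have := I_ge2 j; case: (I j) => [|[]].
- rewrite card_imset ?card_fibre //; exact: perm_inj.
- by apply: imset_f; rewrite inE.
- by apply: imset_f; rewrite inE eqx.
Qed.

Theorem theorem1 (m : nat) (I : 'I_m -> nat) (Delta : {set {set 'I_m}})
    (m_ge1 : (1 <= m)%N)
    (I_ge2 : forall j : 'I_m, (2 <= I j)%N)
    (Delta_complex : simplicial_complex Delta)
    (card_distinct :
       {in facets Delta &, injective (fun D : {set 'I_m} => #|subcell I D|)})
    (I_gt2 : (#|[set j : 'I_m | ~~ (2 < I j)%N]| <= 1)%N) :
  invariance_group I Delta =
    (\bigcap_(D in facets Delta) wreath_perms I D)%SET.
Proof.
apply/setP=> g; apply/idP/bigcapP => [gG D DF | wrg].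
  exact: (invariance_fibres I_ge2 card_distinct I_gt2 gG DF).
rewrite inE eqEsubv; apply/andP; split; apply/subvP=> y.
  case/memv_imgP=> z /ker_confP z0 ->; rewrite lfunE /=.
  apply/ker_confP => D DF u.
  rewrite -[RHS](wreath_margin_free (g := g^-1%g) I_ge2 _ z0 DF u).
    by apply: eq_bigr => p _; rewrite ffunE.
  by move=> D' /wrg; apply: wreath_perms_inv.
move/ker_confP=> y0; apply/memv_imgP; exists [ffun p => y (g p)].
  apply/ker_confP => D DF u.
  rewrite -[RHS](wreath_margin_free I_ge2 wrg y0 DF u).
  by apply: eq_bigr => p _; rewrite ffunE.
by rewrite lfunE; apply/ffunP=> p; rewrite !ffunE permKV.
Qed.
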